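(* Let $G=(V,E)$ be a finite $2$-edge-connected directed graph (loops and multiple edges allowed) and let $u \in V$. Then there exist functions $f_2 : E \to \mathbb{Z}_2$ and $f_3 : E \to \mathbb{Z}_3$ such that $f_2$ is a $\mathbb{Z}_2$-flow, $f_3$ is a $\mathbb{Z}_3$-flow, for every edge $e \in E$ we have $(f_2(e), f_3(e)) \neq (0,0)$ (i.e. $f_2 \times f_3$ is a nowhere-zero $\mathbb{Z}_2 \times \mathbb{Z}_3$-flow), and $f_2(e) = 0$ for every edge $e$ incident to $u$.
   Context: For a directed graph $G=(V,E)$ and an additively written abelian group $A$, a function $f : E \to A$ is an $A$-flow if for every vertex $v \in V$, $\sum_{e \in \delta^+(v)} f(e) = \sum_{e \in \delta^-(v)} f(e)$, where $\delta^+(v)$ (resp. $\delta^-(v)$) is the set of edges whose initial (resp. terminal) vertex is $v$. It is nowhere-zero if $0 \notin f(E)$. The map $f_2 \times f_3 : E \to \mathbb{Z}_2 \times \mathbb{Z}_3$ is $e \mapsto (f_2(e), f_3(e))$; the support $\mathrm{supp}(f_2)$ is the set of edges $e$ with $f_2(e) \neq 0$, and $\delta(u)$ denotes the set of edges incident to $u$. $2$-edge-connectedness refers to the underlying undirected graph. *)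

(* Defs.v *)
From HB Require Import structures.
From mathcomp Require Import all_boot all_order all_algebra.

Set Implicit Arguments.
Unset Strict Implicit.
Unset Printing Implicit Defensive.

Import GRing.Theory.
Local Open Scope ring_scope.

(* Edges form a type of their own, so that loops and parallel edges are
   allowed. *)
Record digraph := Digraph {
  vertex : finType;
  edge : finType;
  init : edge -> vertex;
  term : edge -> vertex
}.

Section Digraph.

Variable G : digraph.

Definition delta_out (v : vertex G) : {set edge G} := [set e | init e == v].

Definition delta_in (v : vertex G) : {set edge G} := [set e | term e == v].

Definition delta (v : vertex G) : {set edge G} := delta_out v :|: delta_in v.

(* Adjacency in the underlying undirected graph after deletion of the edges
   of F. *)
Definition adj_minus (F : {set edge G}) : rel (vertex G) := fun x y =>
  [exists e : edge G, (e \notin F) &&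
    (((init e == x) && (term e == y)) || ((init e == y) && (term e == x)))].

Definition connected_minus (F : {set edge G}) : Prop :=
  forall x y : vertex G, connect (adj_minus F) x y.

(* There is no lower bound on the number of vertices: a graph with a single
   vertex is k-edge-connected for every k. *)
Definition edge_connected (k : nat) : Prop :=
  forall F : {set edge G}, (#|F| < k)%N -> connected_minus F.

Definition is_flow (A : zmodType) (f : edge G -> A) : Prop :=
  forall v : vertex G, \sum_(e in delta_out v) f e = \sum_(e in delta_in v) f e.

Definition nowhere_zero (A : zmodType) (f : edge G -> A) : Prop :=
  forall e : edge G, f e != 0.

End Digraph.

(* Main.v *)
(* As in Seymour's proof of the 6-flow theorem, grow a connected vertex set X
   from {u}, and then build the flows backwards, from X = V down to X = {u}:
   f2 vanishes on the edges meeting X, and f2 x f3 is nonzero on the edges that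
   are not inside X.
   Let B be a leaf of the forest of 2-edge-connected components of G - X.  If
   two edges e, e' join X to B, two edge-disjoint paths in B between their ends
   form an even subgraph C, whose vertex set K is added to X; f2 is 1 on C, and
   f3 can be prescribed on the other new edges except e, because the edges of
   G[X], C and e connect X + K.  Two nonzero values for e' give two values for
   e, as e and e' are the only unprescribed edges leaving K; one of them is
   nonzero.  If a single edge e joins X to B, its end in B is added to X: then e
   and a later edge e2 form a cut, so that the flows are nonzero on e since they
   are nonzero on e2. *)
Require Import Defs.
From HB Require Import structures.
From mathcomp Require Import all_boot all_order all_algebra.
From mathcomp Require Import zify.

Set Implicit Arguments.
Unset Strict Implicit.
Unset Printing Implicit Defensive.

Import Order.TTheory GRing.Theory Num.Theory.
Local Open Scope ring_scope.

Lemma sum_mulrb (T : finType) (A : zmodType) (a : A) (x : T) (Y : {set T}) :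
  \sum_(v in Y) a *+ (x == v) = a *+ (x \in Y).
Proof.
have [xY|xY] := boolP (x \in Y).
  rewrite (bigD1 x) //= eqxx big1 ?addr0 // => v /andP[_ /negPf vx].
  by rewrite eq_sym vx.
rewrite big1 // => v vY; have [xv|//] := eqVneq x v.
by rewrite xv vY in xY.
Qed.

(** * Boundaries, cuts and the prescription of flow values *)

Section Flow.

Variable G : digraph.
Implicit Types (e : edge G) (u v x y : vertex G) (X Y K : {set vertex G}).
Implicit Types (D : {set edge G}).

(** The net outflow at [v]. Boolean multiples keep it a single sum over edges, in which loops cancel
    and sums over vertex sets can be exchanged. *)
Definition boundary (A : zmodType) (f : edge G -> A) v : A :=
  \sum_e (f e *+ (init e == v) - f e *+ (term e == v)).

Definition cross Y e := (init e \in Y) != (term e \in Y).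

Definition inside X e := (init e \in X) && (term e \in X).

Definition joins e x y :=
  ((init e == x) && (term e == y)) || ((init e == y) && (term e == x)).

Definition adj D := adj_minus (~: D).

Section Boundary.

Variable A : zmodType.
Implicit Types (f g : edge G -> A) (a : A).

Lemma is_flowP f : is_flow f <-> forall v, boundary f v = 0.
Proof.
have H v : boundary f v =
    \sum_(e in delta_out v) f e - \sum_(e in delta_in v) f e.
  rewrite /boundary sumrB; congr (_ - _); rewrite [RHS]big_mkcond /=;
    by apply: eq_bigr => e _; rewrite inE mulrb.
split=> h v; last by apply/eqP; rewrite -subr_eq0 -H h.
by rewrite H h subrr.
Qed.

Lemma boundaryD f g v :
  boundary (fun e => f e + g e) v = boundary f v + boundary g v.
Proof.
rewrite -big_split /=; apply: eq_bigr => e _.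
by rewrite !mulrnDl opprD addrACA.
Qed.

Lemma boundaryN f v : boundary (fun e => - f e) v = - boundary f v.
Proof.
rewrite -sumrN; apply: eq_bigr => e _.
by rewrite !mulNrn opprB opprK addrC.
Qed.

Lemma boundary0 v : boundary (fun=> 0 : A) v = 0.
Proof. by rewrite /boundary big1 // => e _; rewrite !mul0rn subr0. Qed.

Lemma boundary_sum (I : finType) (F : I -> edge G -> A) v :
  boundary (fun e => \sum_i F i e) v = \sum_i boundary (F i) v.
Proof.
rewrite exchange_big; apply: eq_bigr => e _ /=.
by rewrite sumrB !sumrMnl.
Qed.

Lemma boundary_edge a e v :
  boundary (fun z => a *+ (z == e)) v
  = a *+ (init e == v) - a *+ (term e == v).
Proof.
rewrite /boundary (bigD1 e) //= eqxx big1 ?addr0 // => z /negPf ->.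
by rewrite !mul0rn subr0.
Qed.

Lemma sum_boundary Y f :
  \sum_(v in Y) boundary f v
  = \sum_e (f e *+ (init e \in Y) - f e *+ (term e \in Y)).
Proof.
by rewrite exchange_big; apply: eq_bigr => e _ /=; rewrite sumrB !sum_mulrb.
Qed.

Lemma sum_boundaryT f : \sum_v boundary f v = 0.
Proof.
have := sum_boundary setT f; rewrite [X in _ = X]big1 => [|e _]; last by rewrite !inE subrr.
by move=> h; rewrite -[RHS]h; apply: eq_bigl => v; rewrite inE.
Qed.

(** Summing boundaries over [Y] leaves the crossing edges only, with signs; here just [e]
    contributes. *)
Lemma flow_cut1 Y f e : is_flow f -> cross Y e ->
  (forall z, cross Y z -> z != e -> f z = 0) -> f e = 0.
Proof.
move=> /is_flowP hf he h; have := sum_boundary Y f.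
rewrite [X in X = _]big1 // (bigD1 e) //= big1 ?addr0 => [|x xe]; last first.
  have [hx|] := boolP (cross Y x); first by rewrite h // !mul0rn subr0.
  by rewrite negbK => /eqP ->; rewrite subrr.
move: he; rewrite /cross; case: (_ \in _); case: (_ \in _) => //= _.
  by rewrite subr0.
by rewrite sub0r => /esym/eqP; rewrite oppr_eq0 => /eqP.
Qed.

Lemma connect_flow D x y a : connect (adj D) x y ->
  exists2 f, (forall e, e \notin D -> f e = 0)
           & forall v, boundary f v = a *+ (x == v) - a *+ (y == v).
Proof.
case/connectP=> s; elim: s x => [|z s IHs] x /= => [_ ->|].
  by exists (fun=> 0) => // v; rewrite boundary0 subrr.
case/andP=> /existsP[e]; rewrite inE negbK => /andP[eD exz] /IHs h /h.
case=> f f0 bf.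
case/orP: exz => /andP[/eqP ex /eqP ez].
  exists (fun w => f w + a *+ (w == e)) => [w wD|v].
    by rewrite f0 // add0r; case: eqVneq wD => // ->; rewrite eD.
  by rewrite boundaryD bf boundary_edge ex ez [LHS]addrC addrA subrK.
exists (fun w => f w + (- a) *+ (w == e)) => [w wD|v].
  by rewrite f0 // add0r; case: eqVneq wD => // ->; rewrite eD.
rewrite boundaryD bf boundary_edge ex ez !mulNrn opprK [LHS]addrC.
by rewrite [X in X + _]addrC addrA subrK.
Qed.

(** Superpose, for each [x], a flow of value [- d x] from [u] to [x] along edges of [D]; the
    contributions at [u] cancel because [d] sums to zero. *)
Lemma boundary_surj D u (d : vertex G -> A) :
  (forall x, d x != 0 -> connect (adj D) u x) -> \sum_x d x = 0 ->
  exists2 f, (forall e, e \notin D -> f e = 0) & forall v, boundary f v = d v.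
Proof.
move=> hc hd.
have h x : exists f : edge G -> A, (forall e, e \notin D -> f e = 0) /\
    forall v, boundary f v = (- d x) *+ (u == v) - (- d x) *+ (x == v).
  have [->|dx] := eqVneq (d x) 0.
    by exists (fun=> 0); split=> // v; rewrite boundary0 oppr0 !mul0rn subrr.
  by have [f] := connect_flow (- d x) (hc x dx); exists f.
have [F hF] := fin_all_exists h.
exists (fun e => \sum_x F x e) => [e eD|v].
  by rewrite big1 // => x _; rewrite (hF x).1.
rewrite boundary_sum (eq_bigr _ (fun x _ => (hF x).2 v)) sumrB sumrMnl sumrN hd.
rewrite oppr0 mul0rn sub0r -sumrN (bigD1 v) //= eqxx mulNrn opprK big1 ?addr0 //.
by move=> x /negPf->; rewrite mulr0n oppr0.
Qed.

(** Add [t - f] on the prescribed edges. The boundary of this change lives on [X] and sums to zero,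
    so a function supported on [D] cancels it. *)
Lemma flow_extension D u X f (t : edge G -> A) : is_flow f ->
  D \subset [set e | inside X e] ->
  (forall x, x \in X -> connect (adj D) u x) ->
  exists g, [/\ is_flow g, forall e, ~~ inside X e -> g e = f e
              & forall e, inside X e -> e \notin D -> g e = t e].
Proof.
move=> /is_flowP hf /subsetP DX hc.
pose g e := if inside X e && (e \notin D) then t e - f e else 0.
have [x bx||r r0 br] := @boundary_surj D u (fun v => - boundary g v).
- apply: hc; apply: contraR bx => xX; rewrite oppr_eq0 /boundary big1 // => e _.
  rewrite /g /inside; case: (eqVneq (init e) x) => [->|_].
    by rewrite (negPf xX) !mul0rn subrr.
  case: (eqVneq (term e) x) => [->|_]; last by rewrite !mulr0n subrr.
  by rewrite (negPf xX) andbF !mul0rn subrr.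
- by rewrite sumrN sum_boundaryT oppr0.
exists (fun e => f e + (g e + r e)); split.
- by apply/is_flowP => v; rewrite !boundaryD hf br subrr addr0.
- move=> e he; rewrite /g (negPf he) /= r0 ?addr0 //.
  by apply: contra he => /DX; rewrite inE.
- by move=> e he eD; rewrite /g he eD /= r0 // addr0 addrC subrK.
Qed.

End Boundary.

(** * Augmenting paths and Menger's theorem *)

(** The residual graph for undirected edges of capacity 1: an edge can be traversed from [x] to [y]
    unless it already carries a unit in that direction. *)
Definition residual (p : edge G -> int) D : rel (vertex G) := fun x y =>
  [exists e in D, [&& init e == x, term e == y & p e <= 0]
               || [&& init e == y, term e == x & 0 <= p e]].

(** Push one unit along the path. As the path is simple, the tail leaves the edges at [x] unchanged,
    so the first edge still has residual capacity. *)
Lemma augment_path (p : edge G -> int) D s x :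
  (forall e, `|p e| <= 1) -> path (residual p D) x s -> uniq (x :: s) ->
  exists q : edge G -> int,
    [/\ forall e, `|q e| <= 1,
        forall v, boundary q v
                  = boundary p v + (1 *+ (x == v) - 1 *+ (last x s == v)),
        forall e, ~~ ((init e \in x :: s) && (term e \in x :: s)) -> q e = p e
      & forall e, e \notin D -> q e = p e].
Proof.
move=> hp; elim: s x => [|y s IHs] x.
  by move=> _ _; exists p; split=> // v; rewrite subrr addr0.
rewrite [path _ _ _]/= [uniq _]/= => /andP[/existsP[e /andP[eD he]] hs].
case/andP=> xs us; have [q [hq bq qp qD]] := IHs y hs us.
have qx z : (init z == x) || (term z == x) -> q z = p z.
  by case/orP=> /eqP hz; apply: qp; rewrite hz (negPf xs) ?andbF.
have [a [ha hae]] : exists a : int, `|q e + a| <= 1 /\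
    forall v, a *+ (init e == v) - a *+ (term e == v)
              = 1 *+ (x == v) - 1 *+ (y == v).
  case/orP: he => /and3P[/eqP ex /eqP ey he]; have := hp e.
    have -> : q e = p e by apply: qx; rewrite ex eqxx.
    by move=> h; exists 1; split; [lia|rewrite ex ey].
  have -> : q e = p e by apply: qx; rewrite ey eqxx orbT.
  move=> h; exists (-1); split; first lia.
  by move=> v; rewrite ex ey !mulNrn opprK addrC.
have ez z : ~~ ((init z \in x :: y :: s) && (term z \in x :: y :: s)) ->
    z != e /\ q z = p z.
  move=> hz; split.
    apply: contraNneq hz => ->.
    by case/orP: he => /and3P[/eqP-> /eqP-> _]; rewrite !inE !eqxx ?orbT.
  by apply: qp; apply: contra hz => /andP[h1 h2]; rewrite !(inE, in_cons) in h1 h2 *;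
    rewrite h1 h2 !orbT.
exists (fun z => q z + a *+ (z == e)); split.
- by move=> z; case: eqVneq => [->|_]; rewrite ?addr0.
- move=> v; rewrite boundaryD bq boundary_edge hae /= -[LHS]addrA; congr (_ + _).
  by rewrite [LHS]addrC addrA subrK.
- by move=> z /ez[/negPf-> ->]; rewrite addr0.
- by move=> z zD; rewrite qD //; case: eqVneq zD => [->|_]; rewrite ?eD ?addr0.
Qed.

(* Menger's theorem for edge-disjoint undirected paths: p is the sum of k paths
   from b to b', with sign -1 where an edge is traversed backwards. *)
Lemma menger_edge D b b' k :
  (forall Y, b \in Y -> b' \notin Y -> k <= #|[set e in D | cross Y e]|)%N ->
  exists p : edge G -> int,
    [/\ forall e, `|p e| <= 1, forall e, e \notin D -> p e = 0
      & forall v, boundary p v = (1 *+ (b == v) - 1 *+ (b' == v)) *+ k].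
Proof.
elim: k => [|k IHk] hk.
  by exists (fun=> 0); split=> // v; rewrite boundary0.
have [Y bY b'Y|p [hp pD bp]] := IHk; first exact: ltnW (hk Y bY b'Y).
have [/connectP[s0 hs0 def_b']|nb] := boolP (connect (residual p D) b b').
  move: def_b'; case: (shortenP hs0) => s hs us _ {}def_b'.
  have [q [hq bq _ qD]] := augment_path hp hs us.
  exists q; split=> // [e eD|v]; first by rewrite qD ?pD.
  by rewrite bq bp -def_b' -mulrSr.
(* Without an augmenting path, each edge of [D] that crosses the reachable set [R] carries one unit
   out of it. The value [k] is then the size of this cut, against [hk]. *)
pose R := [set x | connect (residual p D) b x].
have bR : b \in R by rewrite inE connect0.
have b'R : b' \notin R by rewrite inE.
have hR e x y : x \in R -> y \notin R ->
    [&& init e == x, term e == y & p e <= 0]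
      || [&& init e == y, term e == x & 0 <= p e] -> e \notin D.
  rewrite !inE => hx hy he; apply: contra hy => eD.
  by apply: connect_trans hx (connect1 _); apply/existsP; exists e; rewrite eD.
have := sum_boundary R p.
rewrite (eq_bigr _ (fun v _ => bp v)) sumrMnl sumrB !sum_mulrb bR (negPf b'R).
rewrite subr0 (eq_bigr (fun e => ((e \in D) && cross R e)%:R : int)).
  rewrite -natr_sum => /eqP; rewrite eqr_nat => /eqP hk1.
  have := hk R bR b'R; rewrite [X in (_ < X)%N -> _](_ : _ = k) ?ltnn //.
  rewrite hk1 -sum1dep_card big_mkcond /=; apply: eq_bigr => e _.
  by case: (_ && _).
move=> e _; have [eD|eD] := boolP (e \in D); last by rewrite pD // !mul0rn subr0.
rewrite /cross /=; have := hp e.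
case: (boolP (init e \in R)) => hi; case: (boolP (term e \in R)) => ht //=.
- by rewrite subrr.
- case: (leP (p e) 0) => [pe|]; last by lia.
  by rewrite (negPf (hR e _ _ hi ht _)) // ?eqxx ?pe in eD *.
- case: (leP 0 (p e)) => [pe|]; last by lia.
  by move: (hR e _ _ ht hi); rewrite !eqxx pe eD orbT => /(_ isT).
Qed.

(** * Connectivity, edge cuts and leaf blocks *)

Lemma adj_mono D D' x y : D \subset D' ->
  connect (adj D) x y -> connect (adj D') x y.
Proof.
move/subsetP=> sD; apply: connect_sub => {x y} x y /existsP[e].
rewrite inE negbK => /andP[eD he]; apply: connect1; apply/existsP; exists e.
by rewrite inE negbK sD.
Qed.

Lemma joins_adj D e x y : e \in D -> joins e x y -> adj D x y.
Proof. by move=> eD he; apply/existsP; exists e; rewrite inE negbK eD. Qed.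

Lemma connect_join D X K u a b e : e \in D -> a \in X -> joins e a b ->
  (forall x, x \in X -> connect (adj D) u x) ->
  (forall x, x \in K -> connect (adj D) b x) ->
  forall x, x \in X :|: K -> connect (adj D) u x.
Proof.
move=> eD aX he hX hK x; rewrite inE => /orP[/hX //|/hK].
apply: connect_trans; apply: connect_trans (hX a aX) (connect1 _).
exact: joins_adj he.
Qed.

Lemma connect_uncrossed D Y x y : (forall e, e \in D -> ~~ cross Y e) ->
  connect (adj D) x y -> (x \in Y) = (y \in Y).
Proof.
move=> h; apply: closed_connect => {x y} x y /existsP[e].
rewrite inE negbK => /andP[/h]; rewrite negbK => /eqP he.
by case/orP=> /andP[/eqP<- /eqP<-].
Qed.

Lemma joins_inside X e x y : joins e x y ->
  inside X e = (x \in X) && (y \in X).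
Proof. by case/orP=> /andP[/eqP<- /eqP<-] //; rewrite andbC. Qed.

Lemma joins_cross Y e x y : joins e x y ->
  cross Y e = ((x \in Y) != (y \in Y)).
Proof. by case/orP=> /andP[/eqP<- /eqP<-] //; rewrite eq_sym. Qed.

Lemma boundary_map (A A' : zmodType) (h : {additive A -> A'}) (f : edge G -> A) v :
  boundary (fun e => h (f e)) v = h (boundary f v).
Proof.
by rewrite raddf_sum; apply: eq_bigr => e _; rewrite raddfB !raddfMn.
Qed.

(** Testing [init e] is enough: an edge with nonzero value has both ends in [K] or neither. *)
Lemma flow_restrict (A : zmodType) (f : edge G -> A) K : is_flow f ->
  (forall e, cross K e -> f e = 0) ->
  is_flow (fun e => if init e \in K then f e else 0).
Proof.
move=> /is_flowP hf hK; apply/is_flowP => v; have [vK|vK] := boolP (v \in K).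
  rewrite -[RHS](hf v); apply: eq_bigr => e _; case: ifP => // iK.
  have [tv|_] := eqVneq (term e) v.
    by rewrite hK ?mul0rn // /cross tv iK vK.
  by case: eqVneq iK => [->|]; rewrite ?vK // !mulr0n.
apply: big1 => e _; case: ifP => iK; last by rewrite !mul0rn subrr.
have [tv|_] := eqVneq (term e) v.
  by rewrite hK ?mul0rn ?subrr // /cross tv iK (negPf vK).
by case: eqVneq iK => [->|]; rewrite ?(negPf vK) // !mulr0n subrr.
Qed.

Lemma edge_connected_cut k Y x y : edge_connected G k ->
  x \in Y -> y \notin Y -> (k <= #|[set e | cross Y e]|)%N.
Proof.
move=> hG xY yY; rewrite leqNgt; apply/negP => /hG /(_ x y).
rewrite -[[set _ | _]]setCK => /connect_uncrossed -/(_ Y).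
by rewrite xY (negPf yY); move=> h; suff: true = false by []; apply: h => e;
  rewrite !inE.
Qed.

(* A leaf of the forest of 2-edge-connected components of G - X. *)
Lemma leaf_block X x : x \notin X ->
  exists B : {set vertex G},
    [/\ B != set0, B \subset ~: X,
        (#|[set e | inside (~: X) e && cross B e]| <= 1)%N
      & forall b b' Y, b \in B -> b' \in B -> b \in Y -> b' \notin Y ->
          (2 <= #|[set e in [set e | inside B e] | cross Y e]|)%N].
Proof.
move=> xX.
pose inner B := [set e | inside (~: X) e && cross B e].
pose P B := [&& B != set0, B \subset ~: X & #|inner B| <= 1]%N.
have PX : P (~: X).
  apply/and3P; split=> //; first by apply/set0Pn; exists x; rewrite inE.
  rewrite (_ : inner _ = set0) ?cards0 //; apply/setP => e.
  by rewrite !inE /inside /cross; case: (_ \in _); case: (_ \in _).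
(* The leaf is obtained as a smallest nonempty set off [X] with at most one edge to the rest of G -
   X. *)
case: (arg_minnP (fun B : {set vertex G} => #|B|) PX) => B.
case/and3P=> B0 /subsetP BX hB Bmin; exists B; split=> //; first exact/subsetP.
move=> b b' Y bB b'B bY b'Y; rewrite ltnNge; apply/negP => hM.
set M := [set e in _ | _] in hM.
(* By minimality of [B], [Z] has at least two edges to the rest of G - X, while [M] has at most one
   edge. *)
have key (Z : {set vertex G}) : Z \proper B -> Z != set0 ->
    exists e, [/\ e \in inner Z & e \notin M].
  move=> ZB Z0; have : ~~ P Z.
    by apply: contraL (proper_card ZB) => /Bmin; rewrite -leqNgt.
  rewrite /P Z0 /= negb_and -ltnNge (_ : Z \subset ~: X) /=; last first.
    by apply: subset_trans (proper_sub ZB) _; apply/subsetP.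
  move=> h; have /subsetPn[e ? ?] : ~~ (inner Z \subset M).
    by apply: contraL h => /subset_leq_card h; rewrite -leqNgt (leq_trans h).
  by exists e.
have [||e1] := key (B :&: Y).
- by rewrite properE subsetIl; apply/subsetPn; exists b'; rewrite // !inE (negPf b'Y) andbF.
- by apply/set0Pn; exists b; rewrite inE bB.
rewrite !inE => -[/andP[i1 c1] m1].
have [||e2] := key (B :\: Y).
- by rewrite properE subsetDl; apply/subsetPn; exists b; rewrite // !inE bY.
- by apply/set0Pn; exists b'; rewrite inE b'B b'Y.
rewrite !inE => -[/andP[i2 c2] m2].
(* An edge at a part of [B] that stays in [B] would lie in [M]. So [e1] and [e2] both leave [B] and
   coincide, but the single end in [B] cannot lie in both parts. *)
have [cB1 cB2] : cross B e1 /\ cross B e2.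
  move: c1 c2 m1 m2; rewrite /cross /inside !inE.
  by do 8![case: (_ \in _)].
have e12 : e1 = e2.
  by apply: (card_le1_eqP hB); rewrite inE ?i1 ?i2.
move: c1 c2 cB1; rewrite e12 /cross !inE.
by do 4![case: (_ \in _)].
Qed.

(** * The invariant and its passage from [X :|: K] to [X] *)

Definition rooted u X :=
  u \in X /\ forall x, x \in X -> connect (adj [set e | inside X e]) u x.

(** [~~ inside (~: X) e] says that [e] meets [X]. Inside [X], [f3] is left open, since later steps
    reassign it. *)
Definition outer_flow X := exists (f2 : edge G -> 'Z_2) (f3 : edge G -> 'Z_3),
  [/\ is_flow f2, is_flow f3, forall e, ~~ inside (~: X) e -> f2 e = 0
    & forall e, ~~ inside X e -> (f2 e != 0) || (f3 e != 0)].

Section Attach.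

Variables (u a b : vertex G) (X K : {set vertex G}) (e : edge G).
Variable c : edge G -> 'Z_2.
Hypotheses (hX : rooted u X) (KX : [disjoint K & X]) (aX : a \in X).
Hypotheses (bK : b \in K) (eab : joins e a b) (fc : is_flow c).
Hypothesis cK : forall z, ~~ inside K z -> c z = 0.
Hypothesis hK : forall x, x \in K -> connect (adj [set z | c z != 0]) b x.

(** The edges on which [f3] cannot be prescribed; they connect [X :|: K]. Taking [K] a single vertex
    and [c] zero covers the attachment by one edge. *)
Let D := e |: ([set z | inside X z] :|: [set z | c z != 0]).

Let D_sub : D \subset [set z | inside (X :|: K) z].
Proof.
apply/subsetP => z; rewrite !inE => /or3P[/eqP->|/andP[h1 h2]|h].
- by rewrite (joins_inside _ eab) !inE aX bK orbT.
- by rewrite /inside !inE h1 h2.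
- have: inside K z by apply: contraR h => /cK->.
  by rewrite /inside !inE => /andP[-> ->]; rewrite !orbT.
Qed.

Let D_connect x : x \in X :|: K -> connect (adj D) u x.
Proof.
apply: connect_join aX eab _ _ x => [|x xX|x xK]; first by rewrite !inE eqxx.
  apply: adj_mono (hX.2 x xX); apply/subsetP => z.
  by rewrite !inE => ->; rewrite orbT.
apply: adj_mono (hK xK); apply/subsetP => z.
by rewrite !inE => ->; rewrite !orbT.
Qed.

Lemma rooted_attach : rooted u (X :|: K).
Proof.
split=> [|x xXK]; first by rewrite inE hX.1.
exact: adj_mono D_sub (D_connect xXK).
Qed.

Lemma attach_extension (f t : edge G -> 'Z_3) : is_flow f ->
  exists g, [/\ is_flow g, forall z, ~~ inside (X :|: K) z -> g z = f z
    & forall z, inside (X :|: K) z -> ~~ inside X z -> c z = 0 -> z != e ->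
        g z = t z].
Proof.
move=> hf; have [g [fg g1 g2]] := flow_extension t hf D_sub D_connect.
exists g; split=> // z zXK zX cz ze; apply: g2 => //.
by rewrite !inE negb_or ze negb_or zX cz eqxx.
Qed.

(** The new flows are [f2 + c] and [f3']. The supports of [f2] and [c] are disjoint, as [f2]
    vanishes on every edge meeting [K]. *)
Lemma attach_outer_flow (f2 : edge G -> 'Z_2) (f3 f3' : edge G -> 'Z_3) :
  is_flow f2 -> is_flow f3' -> (forall z, ~~ inside (~: (X :|: K)) z -> f2 z = 0) ->
  (forall z, ~~ inside (X :|: K) z -> (f2 z != 0) || (f3 z != 0)) ->
  (forall z, ~~ inside (X :|: K) z -> f3' z = f3 z) ->
  (forall z, inside (X :|: K) z -> ~~ inside X z -> c z = 0 -> f3' z != 0) ->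
  outer_flow X.
Proof.
move=> /is_flowP h2 h3 z2 nz e3 n3; exists (fun z => f2 z + c z), f3'.
split=> // [|z zX|z zX].
- by apply/is_flowP => v; rewrite boundaryD h2; move/is_flowP: fc => ->; rewrite addr0.
- rewrite z2 ?cK ?addr0 //.
    apply: contra zX => /andP[iK tK].
    by rewrite /inside !inE !(disjointFr KX).
  by apply: contra zX; rewrite /inside !inE !negb_or => /andP[/andP[-> _] /andP[-> _]].
- have [zXK|zXK] := boolP (inside (X :|: K) z).
    rewrite z2 ?add0r; last first.
      move: zXK; rewrite /inside !inE; do 4![case: (_ \in _)] => //.
    by have [cz|//] := eqVneq (c z) 0; apply: n3.
  rewrite cK ?addr0 ?e3 ?nz //; apply: contra zXK.
  by rewrite /inside !inE => /andP[-> ->]; rewrite !orbT.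
Qed.

End Attach.

(** * A connected even subgraph through two vertices *)

Lemma component_uncrossed D b e : e \in D ->
  ~~ cross [set x | connect (adj D) b x] e.
Proof.
move=> eD; have h : joins e (init e) (term e) by rewrite /joins !eqxx.
have h' : joins e (term e) (init e) by rewrite /joins !eqxx orbT.
rewrite negbK !inE; apply/eqP; apply/idP/idP => hc.
  exact: connect_trans hc (connect1 (joins_adj eD h)).
exact: connect_trans hc (connect1 (joins_adj eD h')).
Qed.

(** Menger's theorem with [k = 2] gives an integer function with boundary 2 at [b] and -2 at [b'].
    Modulo 2 it is a flow with the same support, which is then restricted to the component of
    [b]. *)
Lemma cycle_through (B : {set vertex G}) b b' : b \in B -> b' \in B ->
  (forall Y, b \in Y -> b' \notin Y ->
     (2 <= #|[set e in [set e | inside B e] | cross Y e]|)%N) ->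
  exists (K : {set vertex G}) (c : edge G -> 'Z_2),
    [/\ K \subset B, b \in K /\ b' \in K, is_flow c,
        forall z, ~~ inside K z -> c z = 0
      & forall x, x \in K -> connect (adj [set z | c z != 0]) b x].
Proof.
move=> bB b'B /menger_edge[p [hp pB bp]].
pose c0 e : 'Z_2 := (p e)%:~R; pose S0 := [set e | c0 e != 0].
pose K := [set x | connect (adj S0) b x].
pose c e := if init e \in K then c0 e else 0.
have fc0 : is_flow c0.
  apply/is_flowP => v; rewrite (boundary_map (intmul 1) p) bp.
  rewrite raddfMn -[LHS]mulr_natr (_ : 2%:R = 0 :> 'Z_2) ?mulr0 //.
  exact/val_inj.
have p0 e : c0 e = 0 -> p e = 0.
  have := hp e; rewrite /c0 => h h0.
  have : (p e == 0) || (p e == 1) || (p e == -1) by lia.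
  by case/orP=> [/orP[]|] /eqP pe //; move: h0; rewrite pe => /(congr1 val).
have K0 e : cross K e -> c0 e = 0.
  by apply: contraTeq => he; apply: component_uncrossed; rewrite inE.
have bK : b \in K by rewrite inE connect0.
have S0c : S0 \subset [set e | inside B e].
  apply/subsetP => e; apply: contraTT => /pB pe.
  by rewrite inE /c0 pe.
have KB : K \subset B.
  apply/subsetP => x; rewrite inE => /connect_uncrossed <- // e.
  move/(subsetP S0c); rewrite inE /cross => /andP[-> ->] //.
exists K, c; split=> //; first split=> //.
(* Otherwise a net value of 2 would have to leave [K], though [p] vanishes on all edges crossing
   [K]. *)
- apply: contraT => b'K; have := sum_boundary K p.
  rewrite (eq_bigr _ (fun v _ => bp v)) sumrMnl sumrB !sum_mulrb bK (negPf b'K).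
  rewrite [X in _ = X]big1 // => e _; have [/K0/p0->|] := boolP (cross K e).
    by rewrite !mul0rn subrr.
  by rewrite negbK => /eqP->; rewrite subrr.
- exact: flow_restrict.
- move=> z; rewrite /c /inside; case: ifP => //= iK tK.
  by apply: K0; rewrite /cross iK (negPf tK).
- move=> x; rewrite inE => xK.
  (* Walks from [b] in [S0] stay in [K], where [c] agrees with [c0]. *)
  pose R := [set y in K | connect (adj [set z | c z != 0]) b y].
  suff : x \in R by rewrite inE => /andP[].
  rewrite -(@connect_uncrossed S0 R b x) // ?inE ?connect0 // => e eS.
  have /negbNE/eqP ce : ~~ cross K e := component_uncrossed b eS.
  rewrite negbK [init e \in R]in_set [term e \in R]in_set -ce.
  case: (boolP (init e \in K)) => //= iK.
  have /(component_uncrossed b) : e \in [set z | c z != 0].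
    by rewrite inE /c iK; move: eS; rewrite inE.
  by rewrite /cross !inE negbK.
Qed.

(** * Induction on the number of vertices outside [X] *)

Lemma outer_flow_rooted u X : edge_connected G 2 -> rooted u X -> outer_flow X.
Proof.
move=> hG; have [n] := ubnP #|~: X|; elim: n X => // n IHn X hn hX.
have [XT|/subsetPn[x _ xX]] := boolP (setT \subset X).
  exists (fun=> 0), (fun=> 0); split=> //; try by apply/is_flowP => v; rewrite boundary0.
  by move=> e; rewrite /inside !(subsetP XT) ?inE.
have [B [/set0Pn[y yB] BX hB blk]] := leaf_block xX.
have BX' z : z \in B -> (z \in X) = false.
  by move/(subsetP BX); rewrite inE => /negPf.
pose att := [set e | cross B e && ~~ inside (~: X) e].
have ends e : e \in att -> exists a b, [/\ a \in X, b \in B & joins e a b].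
  rewrite inE /cross /inside !inE; case: (boolP (init e \in B)) => iB.
    rewrite (BX' _ iB) /= negbK => /andP[_ tX]; exists (term e), (init e).
    by rewrite /joins !eqxx orbT.
  case: (boolP (term e \in B)) => //= tB.
  rewrite (BX' _ tB) andbT negbK => iX; exists (init e), (term e).
  by rewrite /joins !eqxx.
have cut2 : (2 <= #|[set e | cross B e]|)%N.
  by apply: edge_connected_cut hG yB (_ : u \notin B); apply/negP => /BX'; rewrite hX.1.
have IH (K : {set vertex G}) b : K \subset B -> b \in K -> rooted u (X :|: K) ->
    outer_flow (X :|: K).
  move=> KB bK; apply: IHn; apply: leq_trans (proper_card _) _; last exact: hn.
  rewrite properE setCS subsetUl /=; apply/subsetPn; exists b.
    by rewrite inE BX' // (subsetP KB).
  by rewrite !inE bK orbT.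
have dKX (K : {set vertex G}) : K \subset B -> [disjoint K & X].
  by move=> KB; rewrite disjoints_subset (subset_trans KB).
have [/card_gt1P[e [e' [eA e'A ee']]]|attle1] := ltnP 1 #|att|.
  have [[a [b [aX bB eab]]] [a' [b' [a'X b'B eab']]]] := (ends e eA, ends e' e'A).
  have [K [c [KB [bK b'K] fc cK hK]]] := cycle_through bB b'B (fun Y => blk b b' Y bB b'B).
  have KX := dKX K KB.
  have rK := rooted_attach hX aX bK eab cK hK.
  have [f2 [f3 [h2 h3 z2 nz]]] := IH K b KB bK rK.
  have ext := attach_extension hX aX bK eab cK hK _ h3.
  (* The two nonzero elements of ['Z_3], 1 and -1, are tried on [e']. *)
  pose t s (z : edge G) : 'Z_3 := if z == e' then s else 1.
  have [g1 [fg1 g1f g1t]] := ext (t 1); have [g2 [fg2 g2f g2t]] := ext (t (-1)).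
  have ncK z w w' : w \in X -> w' \in K -> joins z w w' ->
      [/\ inside (X :|: K) z, ~~ inside X z, cross K z & c z = 0].
    move=> wX w'K hz; have wK : w \in K = false by rewrite (disjointFl KX).
    have w'X : w' \in X = false by rewrite (disjointFr KX).
    rewrite !(joins_inside _ hz) (joins_cross _ hz) !inE wX w'K wK w'X orbT.
    by split=> //; apply: cK; rewrite (joins_inside _ hz) wK.
  have [e'1 e'2 e'3 e'4] := ncK _ _ _ a'X b'K eab'.
  suff [s [s0 [g [fg gf gt ge]]]] : exists s, s != 0 /\ exists g : edge G -> 'Z_3,
      [/\ is_flow g, forall z, ~~ inside (X :|: K) z -> g z = f3 z,
          forall z, inside (X :|: K) z -> ~~ inside X z -> c z = 0 -> z != e ->
            g z = t s z & g e != 0].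
    apply: (attach_outer_flow KX fc cK h2 fg z2 nz gf) => z zXK zX cz.
    have [->//|ze] := eqVneq z e; rewrite gt // /t.
    by case: ifP.
  have [g1e|g1e] := eqVneq (g1 e) 0; last by exists 1; split=> //; exists g1.
  have [g2e|g2e] := eqVneq (g2 e) 0; last by exists (-1); split=> //; exists g2.
  have e'e : e' != e by rewrite eq_sym.
  (* If both trials vanish on [e], they agree on every edge crossing [K] other than [e'], hence on
     [e'] too; but 1 and -1 differ modulo 3. *)
  have : g1 e' - g2 e' = 0.
    apply: (@flow_cut1 _ K (fun z => g1 z - g2 z) e') => // [|z zK ze'].
      apply/is_flowP => v; rewrite boundaryD boundaryN.
      by move/is_flowP: fg1 => ->; move/is_flowP: fg2 => ->; rewrite subrr.
    have [->|ze] := eqVneq z e; first by rewrite g1e g2e subrr.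
    have [zXK|zXK] := boolP (inside (X :|: K) z); last by rewrite g1f ?g2f ?subrr.
    have zX : ~~ inside X z.
      apply: contraL zK => /andP[iX tX].
      by rewrite /cross !(disjointFl KX).
    have cz : c z = 0.
      apply: cK; apply: contraL zK => /andP[iK tK].
      by rewrite /cross iK tK.
    by rewrite g1t ?g2t // /t (negPf ze') subrr.
  by rewrite g1t ?g2t // /t eqxx => /(congr1 val).
(* The cut of [B] has at least two edges, at most one going to [X] and at most one within G - X: it
   is [e] together with [e2]. *)
have [e2] : exists e2, e2 \in [set e | inside (~: X) e && cross B e].
  apply/set0Pn; apply: contraTneq cut2 => h0; rewrite -ltnNge ltnS.
  apply: leq_trans attle1; apply: subset_leq_card; apply/subsetP => z.
  rewrite !inE => cz; rewrite cz; move/setP/(_ z): h0.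
  by rewrite !inE cz andbT => ->.
rewrite inE => /andP[i2 c2].
have [e eA] : exists e, e \in att.
  apply/set0Pn; apply: contraTneq cut2 => h0; rewrite -ltnNge ltnS.
  apply: leq_trans hB; apply: subset_leq_card; apply/subsetP => z.
  rewrite !inE => cz; rewrite cz andbT; move/setP/(_ z): h0.
  by rewrite !inE cz => /negbFE.
have only z : cross B z -> z != e2 -> z = e.
  move=> cz ze2; have [iz|iz] := boolP (inside (~: X) z).
    by case/eqP: ze2; apply: (card_le1_eqP hB); rewrite inE ?iz ?i2.
  by apply: (card_le1_eqP attle1) => //; rewrite inE cz.
have [a [b [aX bB eab]]] := ends e eA.
pose K := [set b]; pose c (z : edge G) : 'Z_2 := 0.
have KB : K \subset B by rewrite sub1set.
have bK : b \in K by rewrite inE.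
have fc : is_flow c by apply/is_flowP => v; rewrite boundary0.
have cK z : ~~ inside K z -> c z = 0 by [].
have hK v : v \in K -> connect (adj [set z | c z != 0]) b v.
  by rewrite inE => /eqP->; apply: connect0.
have rK := rooted_attach hX aX bK eab cK hK.
have [f2 [f3 [h2 h3 z2 nz]]] := IH K b KB bK rK.
have [g [fg gf gt]] := attach_extension hX aX bK eab cK hK (fun=> 1) h3.
apply: (attach_outer_flow (dKX K KB) fc cK h2 fg z2 nz gf) => z zXK zX cz.
have [->|ze] := eqVneq z e; last by rewrite gt.
have e2out : ~~ inside (X :|: K) e2.
  move: i2 c2; rewrite /inside /cross !inE => /andP[/negPf-> /negPf->] /=.
  by apply: contraNN => /andP[/eqP-> /eqP->].
have f2e : f2 e = 0.
  apply: z2; rewrite (joins_inside _ eab) !inE.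
  by rewrite aX.
(* As [f2] vanishes on [e], a zero of [g] there would force both [f2] and [f3] to vanish on [e2],
   the other edge of the cut of [B]. *)
apply/eqP => ge; have /orP[/eqP[]|/eqP[]] := nz e2 e2out.
  by apply: flow_cut1 h2 c2 _ => w /only h /h ->.
by rewrite -gf //; apply: flow_cut1 fg c2 _ => w /only h /h ->.
Qed.

End Flow.

Theorem theorem2 (G : digraph) (u : vertex G) (hG : edge_connected G 2) :
  exists (f2 : edge G -> 'Z_2) (f3 : edge G -> 'Z_3),
    [/\ is_flow f2,
        is_flow f3,
        nowhere_zero (fun e => (f2 e, f3 e) : 'Z_2 * 'Z_3)
      & forall e : edge G, e \in delta u -> f2 e = 0].
Proof.
have hu : rooted u [set u].
  by split=> [|x]; rewrite inE // => /eqP->; apply: connect0.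
have [f2 [f3 [h2 h3 z2 nz]]] := outer_flow_rooted hG hu.
(* Only loops at [u] remain; they do not affect boundaries, so [f3] can be set to 1 on them with [D]
   empty. *)
have [|x|g [fg gf gt]] := @flow_extension _ _ set0 u [set u] f3 (fun=> 1) h3.
- exact: sub0set.
- by rewrite inE => /eqP->; apply: connect0.
exists f2, g; split=> // e; last first.
  rewrite !inE => he; apply: z2; rewrite /inside !inE.
  by case/orP: he => ->; rewrite ?andbF.
rewrite xpair_eqE negb_and; have [eu|eu] := boolP (inside [set u] e).
  by rewrite gt ?inE // orbT.
by rewrite gf // nz.
Qed.
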